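(* Let $p$ be a prime, $C\in\mathbb{F}_p^{n\times n}$, and let $m_{C^2}(x)=\prod_{j=1}^r f_j(x)^{k_j}\in\mathbb{F}_p[x]$ be the minimal polynomial of $C^2$, where the $f_j(x)\in\mathbb{F}_p[x]$ are pairwise distinct irreducible polynomials. Let $V_j=\ker f_j(C^2)^{k_j}$ and let $C_j=C_{|V_j}$ be the restriction of $C$ to $V_j$. Then $$N^*(C,C;p)=\prod_{j=1}^r N^*(C_j,C_j;p).$$
   Context: For a finite-dimensional $\mathbb{F}_p$-vector space $V$ and a linear map (or matrix) $C\colon V\to V$, $N^*(C,C;p)=\#\{X\in GL(V)\mid CX=X^{-1}C\}$. (Each $V_j$ is $C$-invariant, so $C_j$ is an endomorphism of $V_j$.) *)

(* Defs.v *)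
From HB Require Import structures.
From mathcomp Require Import all_boot all_order all_fingroup all_algebra.
From mathcomp Require Import all_field.

Set Implicit Arguments.
Unset Strict Implicit.
Unset Printing Implicit Defensive.

Import GRing.Theory.
Local Open Scope ring_scope.

(* N^*(C, C; p) for an endomorphism C of V: the number of X in GL(V) with
   C X = X^-1 C. The type finvect_type 'End(V) is 'End(V) with its finite type
   structure, and X^-1 is a two-sided inverse since X has trivial kernel. *)
Definition Nstar (F : finFieldType) (V : vectType F) (C : 'End(V)) : nat :=
  #|[set X : finvect_type 'End(V) |
       (lker (X : 'End(V)) == 0%VS)
       && (C \o (X : 'End(V)) == (X : 'End(V))^-1 \o C)%VF]|.

Definition mxNstar (F : finFieldType) (n : nat) (C : 'M[F]_n) : nat :=
  #|[set X : 'M[F]_n | (X \in unitmx) && (C *m X == invmx X *m C)]|.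

(* Matrices act on column vectors, x |-> A x, whereas kermx and the other
   kernel constructions of mxalgebra are about row vectors. *)
Definition mxend (F : fieldType) (n : nat) (A : 'M[F]_n) : 'End('cV[F]_n) :=
  linfun (mulmx A).

(* When C does not preserve U, this is C restricted to U followed by a
   projection onto U. *)
Definition restr_end (F : fieldType) (V : vectType F) (C : 'End(V))
    (U : {vspace V}) : 'End(subvs_of U) :=
  linfun (vsproj U \o C \o vsval).

Lemma restr_endE (F : fieldType) (V : vectType F) (C : 'End(V))
    (U : {vspace V}) (u : subvs_of U) :
  (C @: U <= U)%VS -> vsval (restr_end C U u) = C (vsval u).
Proof.
move=> CU; rewrite lfunE /= vsprojK //.
by apply: (subvP CU); rewrite memv_img ?subvsP.
Qed.

(* ker (f(C^2)^k) *)
Definition primary_ker (F : fieldType) (n : nat) (C : 'M[F]_n.+1)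
    (f : {poly F}) (k : nat) : {vspace 'cV[F]_n.+1} :=
  lker (mxend (horner_mx (C ^+ 2) f ^+ k)).

Lemma primary_ker_stable (F : fieldType) (n : nat) (C : 'M[F]_n.+1)
    (f : {poly F}) (k : nat) :
  (mxend C @: primary_ker C f k <= primary_ker C f k)%VS.
Proof.
apply/subvP=> _ /memv_imgP[v + ->]; rewrite !memv_ker !lfunE /= => /eqP fCv0.
have Cf : GRing.comm C (horner_mx (C ^+ 2) f).
  by apply: comm_mx_horner; rewrite /comm_mx mulmxE -exprS -exprSr.
have /esym fC := commrX k Cf.
by rewrite mulmxA mulmxE fC -mulmxE -mulmxA fCv0 mulmx0.
Qed.

(* Main.v *)
Require Import Defs.
From HB Require Import structures.
From mathcomp Require Import all_boot all_order all_fingroup all_algebra.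
From mathcomp Require Import all_field.

Set Implicit Arguments.
Unset Strict Implicit.
Unset Printing Implicit Defensive.

Import GRing.Theory.
Local Open Scope ring_scope.

(** The point is that the condition $C X = X^{-1} C$, for invertible $X$, reads
    $X C X = C$, and that this forces
    $X C^2 = X C (X C X) = (X C X) C X = C^2 X$ ([comm_sqr_conj]).  So every
    solution $X$ commutes with $C^2$, hence with every polynomial in $C^2$, and
    preserves each kernel $V_j = \ker f_j(C^2)^{k_j}$ ([poly_ker_stable]).

    By the primary decomposition, the space is the direct sum of the $V_j$: the
    $f_j^{k_j}$ are pairwise coprime and their product vanishes at $C^2$, so
    Bezout identities give both that the $V_j$ span ([poly_ker_sum_prod]) and
    that they are independent ([poly_ker_directv]).

    An endomorphism preserving all the summands of a direct sum is the same
    thing as a family of endomorphisms of the summands.  Since $C$ preserves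
    them too, invertibility and $X C X = C$ can be checked on each summand, so
    restriction is a bijection from the solutions for $C$ to the families of
    solutions for the $C_j$ ([Nstar_directv]).  Counting the families gives the
    product. *)

(** * Solutions of X C X = C *)

(** Writing the equation without $X^{-1}$ lets it be restricted to subspaces
    without discussing the inverse of a restriction. *)
Definition solutions (F : finFieldType) (V : vectType F) (C : 'End(V)) :
    {set finvect_type 'End(V)} :=
  [set X : finvect_type 'End(V) |
     (lker (X : 'End(V)) == 0%VS) && ((X : 'End(V)) \o C \o X == C)%VF].

Lemma lker0_conj_inv (F : fieldType) (V : vectType F) (C X : 'End(V)) :
  lker X == 0%VS -> (C \o X == X^-1 \o C)%VF = (X \o C \o X == C)%VF.
Proof.
move=> X0; apply/eqP/eqP=> [CX|XCX].
  by rewrite -comp_lfunA CX comp_lfunA lker0_compfV // comp_lfun1l.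
by rewrite -[in RHS]XCX !comp_lfunA lker0_compVf // comp_lfun1l.
Qed.

Lemma card_solutions (F : finFieldType) (V : vectType F) (C : 'End(V)) :
  Nstar C = #|solutions C|.
Proof.
apply: eq_card => X; rewrite !inE.
by case X0: (lker (X : 'End(V)) == 0%VS) => //=; apply: lker0_conj_inv.
Qed.

(** * Matrices as endomorphisms of column vectors *)

Lemma mxendE (F : fieldType) n (A : 'M[F]_n) v : mxend A v = A *m v.
Proof. by rewrite lfunE. Qed.

Lemma mxendM (F : fieldType) n (A B : 'M[F]_n) :
  mxend (A *m B) = (mxend A \o mxend B)%VF.
Proof. by apply/lfunP=> v; rewrite comp_lfunE !mxendE mulmxA. Qed.

Lemma mxend1 (F : fieldType) n : mxend (1%:M : 'M[F]_n) = \1%VF.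
Proof. by apply/lfunP=> v; rewrite mxendE mul1mx lfunE. Qed.

Lemma mxend_bij (F : fieldType) n : bijective (@mxend F n).
Proof.
exists (fun E : 'End('cV[F]_n) => \matrix_(i, j) E (delta_mx j 0) i 0).
  by move=> A; apply/matrixP=> i j; rewrite mxE mxendE -colE mxE.
move=> E; apply/lfunP=> v; rewrite mxendE.
rewrite {2}[v]matrix_sum_delta linear_sum; apply/colP=> i.
rewrite mxE summxE; apply: eq_bigr => j _.
by rewrite big_ord1 linearZ !mxE mulrC.
Qed.

(** A matrix with trivial kernel has an inverse: that of its endomorphism,
    which is itself given by a matrix. *)
Lemma lker_mxend (F : fieldType) n (A : 'M[F]_n) :
  (lker (mxend A) == 0%VS) = (A \in unitmx).
Proof.
apply/idP/idP=> [A0|Au].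
  have [g _ gK] := mxend_bij F n.
  have /mulmx1_unit[] // : A *m g (mxend A)^-1%VF = 1%:M.
  apply: (bij_inj (mxend_bij F n)).
  by rewrite mxendM gK lker0_compfV // mxend1.
apply/lker0P/(can_inj (g := mxend (invmx A))) => v.
by rewrite -comp_lfunE -mxendM mulVmx // mxend1 lfunE.
Qed.

Lemma mxendV (F : fieldType) n (A : 'M[F]_n) :
  A \in unitmx -> mxend (invmx A) = (mxend A)^-1%VF.
Proof.
move=> Au; rewrite -[LHS]comp_lfun1r -(@lker0_compfV _ _ (mxend A)).
  by rewrite comp_lfunA -mxendM mulVmx // mxend1 comp_lfun1l.
by rewrite lker_mxend.
Qed.

Lemma mxNstar_mxend (F : finFieldType) n (C : 'M[F]_n) :
  mxNstar C = Nstar (mxend C).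
Proof.
have bij := mxend_bij F n.
rewrite /Nstar.
rewrite -(@on_card_preimset _ (finvect_type 'End('cV[F]_n)) (@mxend F n)).
  apply: eq_card => X; rewrite !inE lker_mxend.
  case Xu: (X \in unitmx) => //=.
  by rewrite -mxendV // -!mxendM (inj_eq (bij_inj bij)).
exact: (@onW_bij _ (finvect_type 'End('cV[F]_n))).
Qed.

(** * Endomorphisms preserving a direct sum decomposition *)

Section DirectSum.

Variables (F : fieldType) (V : vectType F) (I : finType).
Variable U : I -> {vspace V}.
Hypothesis U_full : (\sum_i U i)%VS = fullv.

Lemma eq_lfun_sumv (W : vectType F) (X Y : 'Hom(V, W)) :
  (forall i u, u \in U i -> X u = Y u) -> X = Y.
Proof.
move=> XY; apply/lfunP=> v.
have /memv_sumP[u Uu ->] : v \in (\sum_i U i)%VS by rewrite U_full memvf.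
by rewrite !linear_sum; apply: eq_bigr => i _; apply: XY; apply: Uu.
Qed.

Hypothesis U_direct : directv (\sum_i U i).

(** The components $X u_i$ of $X v$ again lie in the summands, so $X v = 0$
    makes each of them vanish. *)
Lemma lker0_restr (X : 'End(V)) : (forall i, (X @: U i <= U i)%VS) ->
  (lker X == 0%VS) = [forall i, lker (restr_end X (U i)) == 0%VS].
Proof.
move=> XU; apply/idP/forallP=> [/lker0P Xinj i|Xi].
  apply/lker0P=> u v /(congr1 vsval); rewrite !restr_endE //.
  by move/Xinj; apply: val_inj.
rewrite -subv0; apply/subvP=> v; rewrite memv_ker memv0 => /eqP.
have /memv_sumP[u Uu ->] : v \in (\sum_i U i)%VS by rewrite U_full memvf.
rewrite linear_sum => /(directv_sum_independent U_direct) Xu0.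
apply/eqP; apply: big1 => i _.
have {}Xu0 : X (u i) = 0.
  by apply: Xu0 => // j _; apply: (subvP (XU j)); rewrite memv_img ?Uu.
suff : vsproj (U i) (u i) = 0 by move/(congr1 vsval); rewrite vsprojK ?Uu.
have /lker0P := Xi i; apply; apply: val_inj.
by rewrite linear0 /= restr_endE // vsprojK ?Uu // Xu0.
Qed.

Lemma restr_conj_eq (C X : 'End(V)) :
  (forall i, (C @: U i <= U i)%VS) -> (forall i, (X @: U i <= U i)%VS) ->
  (X \o C \o X == C)%VF =
  [forall i, restr_end X (U i) \o restr_end C (U i) \o restr_end X (U i)
             == restr_end C (U i)]%VF.
Proof.
move=> CU XU; apply/eqP/forallP=> [XCX i|XCXi].
  apply/eqP/lfunP=> u; apply: val_inj.
  by rewrite /= !comp_lfunE !restr_endE // -[in RHS]XCX !comp_lfunE.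
apply: eq_lfun_sumv => i u Uu.
have /eqP/lfunP/(_ (vsproj (U i) u))/(congr1 vsval) := XCXi i.
by rewrite !comp_lfunE !restr_endE // vsprojK.
Qed.

(** Surjectivity of restriction: the endomorphism with blocks [Y i] is the sum
    of the [Y i] precomposed with the projections along the decomposition. *)
Lemma restr_glue (Y : forall i, 'End(subvs_of (U i))) :
  exists2 X : 'End(V), (forall i, (X @: U i <= U i)%VS) &
    forall i, restr_end X (U i) = Y i.
Proof.
pose pr := sumv_pi_for (esym U_full).
have prU i v : pr i v \in U i by apply: memv_sum_pi.
(* By directness, the decomposition of u that pr computes is the trivial one. *)
have pr_id i j u : u \in U i -> pr j u = if j == i then u else 0.
  move=> Uu; have /directv_sum_unique U_uniq := U_direct.
  have := U_uniq (pr^~ u) (fun j => if j == i then u else 0).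
  rewrite -big_mkcond big_pred1_eq sumv_pi_uniq_sum ?memvf //; last first.
    exact/filter_uniq/index_enum_uniq.
  rewrite eqxx => U_id; apply/eqP; move: j isT; apply/forall_inP.
  by rewrite -U_id // => l _; case: eqP => [->|]; rewrite ?mem0v.
pose X : 'End(V) :=
  \sum_i (linfun vsval \o Y i \o linfun (vsproj (U i)) \o pr i)%VF.
have XE i u : u \in U i -> X u = vsval (Y i (vsproj (U i) u)).
  move=> Uu; rewrite sum_lfunE (bigD1 i) //= big1 => [|j /negPf ji].
    by rewrite !comp_lfunE !lfunE /= (pr_id i) // eqxx addr0.
  by rewrite !comp_lfunE (pr_id i) // ji !linear0.
have XU i : (X @: U i <= U i)%VS.
  by apply/subvP=> _ /memv_imgP[u Uu ->]; rewrite (XE i) ?subvsP.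
exists X => // i; apply/lfunP=> u; apply: val_inj.
by rewrite /= restr_endE // (XE i) ?subvsP // vsvalK.
Qed.

End DirectSum.

(** The last hypothesis is what makes the product formula hold: a solution that
    mixed the summands would not restrict to them. *)
Lemma Nstar_directv (F : finFieldType) (V : vectType F) (I : finType)
    (U : I -> {vspace V}) (C : 'End(V)) :
  (\sum_i U i)%VS = fullv -> directv (\sum_i U i) ->
  (forall i, (C @: U i <= U i)%VS) ->
  (forall X : 'End(V), (X \o C \o X)%VF = C ->
     forall i, (X @: U i <= U i)%VS) ->
  Nstar C = (\prod_i Nstar (restr_end C (U i)))%N.
Proof.
move=> U_full U_direct CU solU.
under eq_bigr do rewrite card_solutions.
rewrite card_solutions -cardsXn.
pose res (X : finvect_type 'End(V)) :
    {dffun forall i, finvect_type 'End(subvs_of (U i))} :=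
  [ffun i => restr_end X (U i)].
have in_res (X : finvect_type 'End(V)) :
    (forall i, ((X : 'End(V)) @: U i <= U i)%VS) ->
  (X \in solutions C) =
    (res X \in setXn (fun i => solutions (restr_end C (U i)))).
  move=> XU; rewrite in_setXn inE (lker0_restr U_full U_direct XU).
  rewrite (restr_conj_eq U_full CU XU).
  apply/andP/forallP=> [[/forallP Xk /forallP Xe] i|Xs].
    by rewrite inE ffunE Xk Xe.
  by split; apply/forallP=> i; have := Xs i; rewrite inE ffunE => /andP[].
have solU' (X : finvect_type 'End(V)) :
    X \in solutions C -> forall i, ((X : 'End(V)) @: U i <= U i)%VS.
  by rewrite inE => /andP[_ /eqP/solU].
rewrite -(@card_in_imset _ _ res (solutions C)); last first.
  move=> X Y /solU' XU /solU' YU /ffunP eXY.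
  apply: (eq_lfun_sumv U_full) => i u Uu.
  have /lfunP/(_ (vsproj (U i) u))/(congr1 vsval) := eXY i.
  by rewrite !ffunE !restr_endE // vsprojK.
apply: eq_card => Y; apply/imsetP/idP=> [[X solX ->]|solY].
  by rewrite -in_res //; apply: solU'.
have [X XU XY] := restr_glue U_full U_direct Y.
have YX : Y = res X by apply/ffunP=> i; rewrite ffunE XY.
by exists X; rewrite // in_res // -YX.
Qed.

(** * Primary decomposition *)

Section PolyKernel.

Variables (F : fieldType) (n : nat) (A : 'M[F]_n.+1).

Definition poly_ker (p : {poly F}) : {vspace 'cV[F]_n.+1} :=
  lker (mxend (horner_mx A p)).

Lemma mem_poly_ker p v : (v \in poly_ker p) = (horner_mx A p *m v == 0).
Proof. by rewrite memv_ker mxendE. Qed.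

Lemma horner_mxMv p q (v : 'cV_n.+1) :
  horner_mx A (p * q) *m v = horner_mx A p *m (horner_mx A q *m v).
Proof. by rewrite rmorphM -mulmxE mulmxA. Qed.

Lemma poly_ker_dvd p q : p %| q -> (poly_ker p <= poly_ker q)%VS.
Proof.
case/dvdpP=> c ->; apply/subvP=> v; rewrite !mem_poly_ker horner_mxMv.
by move/eqP->; rewrite mulmx0.
Qed.

(** If $a p + b q = 1$, then $v = (b q)(A) v + (a p)(A) v$, where $p$ kills the
    first term and $q$ the second. *)
Lemma poly_ker_coprimeM p q :
  coprimep p q -> (poly_ker (p * q) <= poly_ker p + poly_ker q)%VS.
Proof.
case/Bezout_eq1_coprimepP=> -[a b] /= ab1; apply/subvP=> v.
rewrite mem_poly_ker => /eqP pqv0.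
have -> : v = horner_mx A (b * q) *m v + horner_mx A (a * p) *m v.
  by rewrite -mulmxDl -rmorphD addrC ab1 rmorph1 mul1mx.
apply: memv_add; rewrite mem_poly_ker -horner_mxMv.
  by rewrite mulrCA horner_mxMv pqv0 mulmx0.
by rewrite mulrCA [q * p]mulrC horner_mxMv pqv0 mulmx0.
Qed.

Lemma poly_ker_coprime_cap p q v :
  coprimep p q -> v \in poly_ker p -> v \in poly_ker q -> v = 0.
Proof.
case/Bezout_eq1_coprimepP=> -[a b] /= ab1.
rewrite !mem_poly_ker => /eqP pv0 /eqP qv0.
have -> : v = horner_mx A (a * p) *m v + horner_mx A (b * q) *m v.
  by rewrite -mulmxDl -rmorphD ab1 rmorph1 mul1mx.
by rewrite !horner_mxMv pv0 qv0 !mulmx0 addr0.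
Qed.

Lemma poly_ker_stable (B : 'M[F]_n.+1) p :
  comm_mx B A -> (mxend B @: poly_ker p <= poly_ker p)%VS.
Proof.
move=> BA; apply/subvP=> _ /memv_imgP[v + ->].
rewrite !mem_poly_ker mxendE => /eqP pv0.
by rewrite mulmxA -comm_mx_horner // -mulmxA pv0 mulmx0.
Qed.

Variables (I : finType) (g : I -> {poly F}).
Hypothesis g_coprime : forall i j, i != j -> coprimep (g i) (g j).

Lemma poly_ker_sum_prod :
  (poly_ker (\prod_i g i) <= \sum_i poly_ker (g i))%VS.
Proof.
elim: (index_enum I) (index_enum_uniq I) => [_|i s IHs /= /andP[i_s s_uniq]].
  apply/subvP=> v; rewrite !big_nil mem_poly_ker rmorph1 mul1mx => /eqP->.
  exact: mem0v.
rewrite !big_cons; apply: subv_trans (addvS (subvv _) (IHs s_uniq)).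
apply: poly_ker_coprimeM; rewrite big_seq.
elim/big_rec: _ => [|j q js iq]; first exact: coprimep1.
rewrite coprimepMr iq andbT g_coprime //.
by apply: contraNneq i_s => ->.
Qed.

(** In a vanishing sum of $u_j \in \ker g_j(A)$, the vector $u_i$ is minus the
    sum of the others, so it is also killed by $\prod_{j \neq i} g_j(A)$, where
    the product is coprime to $g_i$. *)
Lemma poly_ker_directv : directv (\sum_i poly_ker (g i)).
Proof.
apply/directv_sum_independent=> u Ku u0 i _.
apply: (@poly_ker_coprime_cap (g i) (\prod_(j | j != i) g j)); last 2 first.
- exact: Ku.
- move/eqP: u0; rewrite (bigD1 i) //= addr_eq0 => /eqP->.
  rewrite rpredN rpred_sum // => j ji; apply: subvP (Ku j isT).
  by apply: poly_ker_dvd; rewrite (bigD1 j) //= dvdp_mulIl.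
elim/big_rec: _ => [|j q ji iq]; first exact: coprimep1.
by rewrite coprimepMr iq g_coprime // eq_sym.
Qed.

End PolyKernel.

(** * The product formula *)

(** Substituting $x c x$ for the last $c$ of $x c c$, or for the first $c$ of
    $c c x$, gives the same word $x c x c x$. *)
Lemma comm_sqr_conj (R : nzRingType) (c x : R) :
  x * c * x = c -> GRing.comm x (c ^+ 2).
Proof.
move=> xcx; rewrite /GRing.comm expr2 -{2}xcx.
by rewrite -{3}xcx !mulrA.
Qed.

Lemma irreducible_coprimep (F : fieldType) (f g : {poly F}) :
  irreducible_poly f -> irreducible_poly g -> ~~ (f %= g) -> coprimep f g.
Proof.
move=> f_irr g_irr; rewrite irreducible_poly_coprime //.
by apply: contra => fg; apply: g_irr.2 fg; rewrite gtn_eqF // f_irr.1.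
Qed.

(** The kernels decompose the space because the minimal polynomial vanishes
    at $C^2$, and every solution preserves them because it commutes with $C^2$. *)
Lemma mxNstar_primary (F : finFieldType) (n : nat)
    (C : 'M[F]_n.+1) (r : nat) (f : 'I_r -> {poly F}) (k : 'I_r -> nat) :
  (forall j, irreducible_poly (f j)) ->
  (forall i j, i != j -> ~~ (f i %= f j)) ->
  (forall j, (0 < k j)%N) ->
  mxminpoly (C ^+ 2) = \prod_(j < r) f j ^+ k j ->
  mxNstar C =
    (\prod_(j < r) Nstar (restr_end (mxend C) (primary_ker C (f j) (k j))))%N.
Proof.
move=> f_irr f_distinct k_gt0 f_fact.
have primaryE j : primary_ker C (f j) (k j) = poly_ker (C ^+ 2) (f j ^+ k j).
  by rewrite /primary_ker /poly_ker rmorphXn.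
have fk_coprime i j : i != j -> coprimep (f i ^+ k i) (f j ^+ k j).
  move=> ij; rewrite coprimep_expl // coprimep_expr //.
  by apply: irreducible_coprimep; rewrite ?f_distinct.
rewrite mxNstar_mxend; apply: Nstar_directv => [|||X XCX j].
- apply/eqP; rewrite (eq_bigr _ (fun j _ => primaryE j)) eqEsubv subvf /=.
  apply: subv_trans (poly_ker_sum_prod _ fk_coprime).
  rewrite -f_fact; apply/subvP=> v _.
  by rewrite mem_poly_ker mx_root_minpoly mul0mx.
- apply/directv_sum_independent=> u Ku.
  have direct := poly_ker_directv (C ^+ 2) fk_coprime.
  apply: (directv_sum_independent direct) => j _.
  by rewrite -primaryE; apply: Ku.
- by move=> j; apply: primary_ker_stable.
have [M _ MK] := mxend_bij F n.+1.
rewrite primaryE -[X]MK; apply/poly_ker_stable/comm_sqr_conj.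
by apply: (bij_inj (mxend_bij _ _)); rewrite -!mulmxE !mxendM MK.
Qed.

(* The f j are distinct as irreducible factors, i.e. pairwise non-associate;
   for monic f j this is the same as being pairwise different. *)
Theorem proposition1p4 (p : nat) (p_prime : prime p) (n : nat)
    (C : 'M['F_p]_n.+1) (r : nat) (f : 'I_r -> {poly 'F_p}) (k : 'I_r -> nat)
    (f_irr : forall j, irreducible_poly (f j))
    (f_distinct : forall i j, i != j -> ~~ (f i %= f j))
    (k_gt0 : forall j, (0 < k j)%N)
    (f_fact : mxminpoly (C ^+ 2) = \prod_(j < r) f j ^+ k j) :
  mxNstar C =
    (\prod_(j < r) Nstar (restr_end (mxend C) (primary_ker C (f j) (k j))))%N.
Proof. exact: mxNstar_primary. Qed.
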